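(* Let $\ell\ge1$, $m\ge0$ and $\mu,\nu\in\Lambda^\ell_{st}(m)$. There exists a bijection $\varphi_\ell:\mathrm{ParMat}^\flat_{\nu,\mu}\to\mathrm{SST}^2_{\nu,\mu}$.
   Context: $\Lambda^\ell_{st}(m)$ is the set of $\ell$-tuples $\mu=(\mu^{(1)},\dots,\mu^{(\ell)})$ of possibly empty finite sequences of positive integers with total sum $m$; $\mathrm{Par}^\ell(m)$ the subset in which each $\mu^{(p)}$ is a partition (weakly decreasing). For $\mu,\nu\in\Lambda^\ell_{st}(m)$, $\mathrm{ParMat}^\flat_{\nu,\mu}$ is the set of pairs $(A,P)$ where $A=(a_{(p,i),(q,j)})$ is a matrix of nonnegative integers with rows indexed by $(p,i)$, $1\le p\le\ell$, $1\le i\le l(\nu^{(p)})$, and columns by $(q,j)$, $1\le q\le\ell$, $1\le j\le l(\mu^{(q)})$, such that $\sum_{q,j}a_{(p,i),(q,j)}=\nu^{(p)}_i$ and $\sum_{p,i}a_{(p,i),(q,j)}=\mu^{(q)}_j$, and $P=(\eta_{(p,i),(q,j)})$ where each $\eta_{(p,i),(q,j)}$ is a partition with all parts $\le a_{(p,i),(q,j)}$ and with at most $\min\{p,q\}-1$ parts. For $\lambda\in\mathrm{Par}^\ell(m)$ and $\mu\in\Lambda^\ell_{st}(m)$, a $\lambda$-tableau of type $\mu$ fills the Young diagrams of $\lambda^{(1)},\dots,\lambda^{(\ell)}$ with symbols $i_p=(i,p)$ ($p\in\{1,\dots,\ell\}$, $i\ge1$) so that $i_p$ occurs exactly $\mu^{(p)}_i$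 times; symbols are totally ordered by $(i_1,p_1)<(i_2,p_2)$ iff $p_1<p_2$, or $p_1=p_2$ and $i_1<i_2$. It is semistandard if, in each component, entries weakly increase along rows and strictly increase down columns, and every entry $i_p$ lying in the $j$-th component satisfies $p\ge j$. $\mathrm{SST}(\lambda,\mu)$ denotes the set of semistandard $\lambda$-tableaux of type $\mu$, and $\mathrm{SST}^2_{\nu,\mu}:=\bigcup_{\lambda\in\mathrm{Par}^\ell(m)}\mathrm{SST}(\lambda,\nu)\times\mathrm{SST}(\lambda,\mu)$. *)

(* Defs.v *)
From mathcomp Require Import all_boot.
Set Implicit Arguments. Unset Strict Implicit. Unset Printing Implicit Defensive.

(* An l-tuple mu = (mu^(1),...,mu^(l)) of finite sequences of positive integers
   is represented as  mu : seq (seq nat)  with  size mu = l;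
   mu^(p) = nth [::] mu p.-1  and  mu^(p)_i = nth 0 (nth [::] mu p.-1) i.-1
   (p, i are 1-indexed). *)

Definition Lambda_st (l m : nat) (mu : seq (seq nat)) : Prop :=
  size mu = l /\ all (all (fun x => 0 < x)) mu /\ sumn (map sumn mu) = m.

Definition is_partition (s : seq nat) : bool :=
  all (fun x => 0 < x) s && sorted geq s.

Definition Par (l m : nat) (lam : seq (seq nat)) : Prop :=
  Lambda_st l m lam /\ all is_partition lam.

Definition part (mu : seq (seq nat)) (p i : nat) : nat :=
  nth 0 (nth [::] mu p.-1) i.-1.

(* the index set {(p,i) : 1 <= p <= l, 1 <= i <= l(mu^(p))}, listed in some
   fixed order; matrices are stored positionally w.r.t. this list *)
Definition idx (mu : seq (seq nat)) : seq (nat * nat) :=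
  flatten [seq [seq (p, i) | i <- iota 1 (size (nth [::] mu p.-1))]
          | p <- iota 1 (size mu)].

Definition entry {T} (x0 : T) (A : seq (seq T)) (k k' : nat) : T :=
  nth x0 (nth [::] A k) k'.

(* ParMat^flat_{nu,mu}: pairs (A, P).  Row k of A (k < size (idx nu)) is the
   row indexed by (p,i) = nth (0,0) (idx nu) k; column k' is indexed by
   (q,j) = nth (0,0) (idx mu) k'. *)
Definition ParMat (nu mu : seq (seq nat))
    (AP : seq (seq nat) * seq (seq (seq nat))) : Prop :=
  let A := AP.1 in let P := AP.2 in
  let R := idx nu in let C := idx mu in
  [/\ size A = size R,
      (forall k, k < size R -> size (nth [::] A k) = size C),
      (forall k, k < size R ->
          sumn (nth [::] A k) = part nu (nth (0,0) R k).1 (nth (0,0) R k).2),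
      (forall k', k' < size C ->
          sumn [seq entry 0 A k k' | k <- iota 0 (size R)]
          = part mu (nth (0,0) C k').1 (nth (0,0) C k').2) &
      size P = size R /\
      (forall k, k < size R -> size (nth [::] P k) = size C) /\
      (forall k k', k < size R -> k' < size C ->
          let eta := entry [::] P k k' in
          [/\ is_partition eta,
              all (fun x => x <= entry 0 A k k') eta &
              size eta <= (minn (nth (0,0) R k).1 (nth (0,0) C k').1).-1])].

(* Tableaux.  A symbol i_p is the pair (i, p).  A multitableau is
   T : seq (seq (seq (nat * nat))): component c (0-indexed, i.e. the (c+1)-th
   component), row r, column j. *)
Definition tableau := seq (seq (seq (nat * nat))).

Definition sym_lt (x y : nat * nat) : bool :=
  (x.2 < y.2) || ((x.2 == y.2) && (x.1 < y.1)).
Definition sym_le (x y : nat * nat) : bool := (x == y) || sym_lt x y.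

Definition shape (T : tableau) : seq (seq nat) := map (map size) T.

Definition mult (mu : seq (seq nat)) (x : nat * nat) : nat :=
  if (0 < x.1) && (0 < x.2) then part mu x.2 x.1 else 0.

Definition tab_entry (T : tableau) (c r j : nat) : nat * nat :=
  nth (0,0) (nth [::] (nth [::] T c) r) j.

Definition SST (lam mu : seq (seq nat)) (T : tableau) : Prop :=
  [/\ shape T = lam,
      (forall x, count_mem x (flatten (flatten T)) = mult mu x),
      (forall c r, sorted sym_le (nth [::] (nth [::] T c) r)),
      (forall c r j, j < size (nth [::] (nth [::] T c) r.+1) ->
          sym_lt (tab_entry T c r j) (tab_entry T c r.+1 j)) &
      (forall c, all (fun x : nat * nat => c.+1 <= x.2) (flatten (nth [::] T c)))].

Definition SST2 (l m : nat) (nu mu : seq (seq nat)) (ST : tableau * tableau) : Prop :=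
  exists lam, [/\ Par l m lam, SST lam nu ST.1 & SST lam mu ST.2].

Definition bijection_between {A B : Type} (P : A -> Prop) (Q : B -> Prop)
    (f : A -> B) : Prop :=
  [/\ (forall x, P x -> Q (f x)),
      (forall x y, P x -> P y -> f x = f y -> x = y) &
      (forall y, Q y -> exists2 x, P x & f x = y)].

(* Main.v *)
Require Import Defs.
From mathcomp Require Import all_boot zify.
From Stdlib Require Import ClassicalEpsilon.

(* The partition [eta] attached to a matrix entry [a] is a weakly decreasing
   sequence [a >= eta_1 >= eta_2 >= ...], so its consecutive differences split
   [a] into at most [min(p, q)] nonnegative integers.  Hence an element of
   [ParMat] is a family of [l] ordinary matrices, the [c]-th one supported on the
   rows and columns of blocks [>= c], whose sum has margins [nu] and [mu].  The
   Robinson-Schensted-Knuth correspondence, applied to each of these matrices,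
   gives the [c]-th components of the two tableaux: margins become contents, so
   the support condition becomes the condition [p >= c] on the entries [i_p].
   RSK itself is obtained from growth diagrams: by Fomin's local rule the matrix
   and the pair of chains of partitions on the far boundary of the diagram
   determine each other, and a chain of partitions growing by horizontal strips
   is a semistandard tableau. *)

Set Implicit Arguments. Unset Strict Implicit. Unset Printing Implicit Defensive.

(** * Bijections from relations *)

(** Choice picks for each [x] a related [y]. This lets the correspondence be described by the
    existence of growth diagrams; [b0] is the value that choice needs outside [P]. *)
Lemma bijection_of_relation (A B : Type) (b0 : B) (P : A -> Prop) (Q : B -> Prop)
    (Rel : A -> B -> Prop) :
  (forall x, P x -> exists2 y, Q y & Rel x y) ->
  (forall y, Q y -> exists2 x, P x & Rel x y) ->
  (forall x y y', P x -> Q y -> Q y' -> Rel x y -> Rel x y' -> y = y') ->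
  (forall x x' y, P x -> P x' -> Q y -> Rel x y -> Rel x' y -> x = x') ->
  exists f, bijection_between P Q f.
Proof.
move=> tot sur fun_ inj.
have inhB : inhabited B by exact: inhabits b0.
pose f x := epsilon inhB (fun y => Q y /\ Rel x y).
have fP x : P x -> Q (f x) /\ Rel x (f x).
  move=> /tot [y Qy Ry]; rewrite /f.
  by apply: (epsilon_spec inhB (fun y => Q y /\ Rel x y)); exists y.
exists f; split.
- by move=> x /fP [].
- move=> x x' Px Px' E; have [Qx Rx] := fP x Px; have [Qx' Rx'] := fP x' Px'.
  by apply: (inj x x' (f x)) => //; rewrite E.
- move=> y Qy; have [x Px Rxy] := sur y Qy; exists x => //.
  by have [Qx Rx] := fP x Px; apply: (fun_ x).
Qed.

(** * Finite sums *)

Definition weight (N : nat) (f : nat -> nat) : nat := \sum_(i < N) f i.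

Lemma weightS N f : weight N.+1 f = weight N f + f N.
Proof. by rewrite /weight big_ord_recr. Qed.

Lemma eq_weight N f g : (forall i, i < N -> f i = g i) -> weight N f = weight N g.
Proof. by move=> fg; apply: eq_bigr => i _; apply: fg. Qed.

Lemma weightD N f g : weight N (fun i => f i + g i) = weight N f + weight N g.
Proof. exact: big_split. Qed.

Lemma weight_eq0 N f : (forall i, i < N -> f i = 0) -> weight N f = 0.
Proof. by move=> f0; apply: big1 => i _; apply: f0. Qed.

Lemma weight_eq0P N f : weight N f = 0 -> forall i, i < N -> f i = 0.
Proof.
elim: N => // N IH; rewrite weightS => E i iN.
have [iN'|->] : i < N \/ i = N by lia.
- by apply: IH => //; lia.
- by lia.
Qed.

Lemma leq_weight N M f : N <= M -> weight N f <= weight M f.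
Proof.
elim: M => [|M IH] NM; first by have -> : N = 0 by lia.
case: (ltngtP N M.+1) NM => // [NM|->] _ //.
by rewrite weightS; have := IH NM; lia.
Qed.

Lemma exchange_weight M N (f : nat -> nat -> nat) :
  weight M (fun i => weight N (f i)) = weight N (fun j => weight M (fun i => f i j)).
Proof. exact: exchange_big. Qed.

Lemma sumn_weight s : sumn s = weight (size s) (nth 0 s).
Proof. by rewrite sumnE (big_nth 0) big_mkord. Qed.

Lemma sumn_mkseq f N : sumn (mkseq f N) = weight N f.
Proof.
by rewrite sumn_weight size_mkseq; apply: eq_weight => i iN; rewrite nth_mkseq.
Qed.

Lemma weight_support M N f : M <= N -> (forall i, M <= i -> f i = 0) ->
  weight N f = weight M f.
Proof.
move=> MN f0; elim: N MN => [|N IH] MN; first by have -> : M = 0 by lia.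
have [h|->] : M <= N \/ M = N.+1 by lia.
  by rewrite weightS IH // f0 // addn0.
by [].
Qed.

(** The differences [g i - f i] sum to zero. This is how a step that adds no cells is seen to leave
    a partition unchanged. *)
Lemma weight_le_eq N f g : (forall i, f i <= g i) -> weight N g = weight N f ->
  forall i, i < N -> g i = f i.
Proof.
move=> fg E i iN.
have : weight N (fun i => g i - f i) = 0.
  have := weightD N f (fun i => g i - f i).
  rewrite (eq_weight (g := g)); first by lia.
  by move=> j _; have := fg j; lia.
by move=> /weight_eq0P /(_ i iN); have := fg i; lia.
Qed.

(** * Growth diagrams *)

(* A partition is a weakly decreasing function with finite support, and
   [hstrip w y] says that [y / w] is a horizontal strip, i.e. that [w] and [y]
   interlace. *)
Definition hstrip (w y : nat -> nat) : Prop := forall i, y i.+1 <= w i <= y i.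

Lemma hstrip_anti w y i : hstrip w y -> y i.+1 <= y i.
Proof. by move=> /(_ i); lia. Qed.

(** A horizontal strip adds at most one row, so [r] steps from the empty partition reach at most [r]
    rows. *)
Lemma hstrip_support (n : nat) (y : nat -> nat -> nat) :
  (forall i, y 0 i = 0) -> (forall r, r < n -> hstrip (y r) (y r.+1)) ->
  forall r i, r <= n -> r <= i -> y r i = 0.
Proof.
move=> y0 yh; elim=> [|r IH] [|i] // rn ri.
by have := yh r rn i; have := IH i; lia.
Qed.

Lemma hstrip_chain_le (n : nat) (y : nat -> nat -> nat) i :
  (forall r, r < n -> hstrip (y r) (y r.+1)) ->
  forall r r', r <= r' -> r' <= n -> y r i <= y r' i.
Proof.
move=> yh r; elim=> [|r' IH] rr rn; first by have -> : r = 0 by lia.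
case: (ltngtP r r'.+1) rr => // [ij|->] _ //.
by have := yh r' rn i; have := IH ij; lia.
Qed.

(* The cell relation is Fomin's local rule for the Robinson-Schensted-Knuth
   correspondence, written piecewise-linearly on the parts of the four corners
   and free of subtractions. *)
Definition cell (k : nat) (w y z x : nat -> nat) : Prop :=
  x 0 = maxn (y 0) (z 0) + k /\
  forall i, x i.+1 + w i = minn (y i) (z i) + maxn (y i.+1) (z i.+1).

(** [G r s] is the partition at the vertex in row [r] and column [s]; [K r s] is the matrix entry in
    the cell that has this vertex as its corner nearest the origin. *)
Definition growth (R S : nat) (K : nat -> nat -> nat)
    (G : nat -> nat -> nat -> nat) : Prop :=
  [/\ forall s i, s <= S -> G 0 s i = 0,
      forall r i, r <= R -> G r 0 i = 0,
      forall r s, r < R -> s < S ->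
        cell (K r s) (G r s) (G r s.+1) (G r.+1 s) (G r.+1 s.+1),
      forall r s, r < R -> s <= S -> hstrip (G r s) (G r.+1 s) &
      forall r s, r <= R -> s < S -> hstrip (G r s) (G r s.+1)].

(** Recursion on the rows builds each row as a function, by an inner recursion along it; [a 0 = b 0]
    makes the two borders agree at the origin. *)
Lemma double_recursion (X : Type) (a b : nat -> X) (f : nat -> nat -> X -> X -> X -> X) :
  a 0 = b 0 ->
  exists F : nat -> nat -> X,
    [/\ forall s, F 0 s = a s, forall r, F r 0 = b r &
        forall r s, F r.+1 s.+1 = f r s (F r s) (F r s.+1) (F r.+1 s)].
Proof.
move=> ab.
pose row r (g : nat -> X) := fix h s :=
  match s with 0 => b r.+1 | s'.+1 => f r s' (g s') (g s'.+1) (h s') end.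
pose F := fix F r := match r with 0 => a | r'.+1 => row r' (F r') end.
by exists F; split => // -[|r].
Qed.

Lemma growth_exists (R S : nat) (K : nat -> nat -> nat) :
  exists G, growth R S K G.
Proof.
(* Forward form of [cell]. The truncated subtraction is exact, because interlacing gives
   [w j <= minn (y j) (z j)]. *)
pose rule r s (w y z : nat -> nat) i :=
  if i is j.+1 then minn (y j) (z j) + maxn (y i) (z i) - w j
  else maxn (y 0) (z 0) + K r s.
have [G [G0s Gr0 GE]] :=
  @double_recursion _ (fun _ _ => 0) (fun _ _ => 0) rule erefl.
(* The horizontal edges of row [r.+1] come from those of row [r] and the vertical edges between the
   two rows; the next vertical edges then follow. *)
have H r : forall s, hstrip (G r s) (G r.+1 s) /\ hstrip (G r s) (G r s.+1).
  elim: r => [|r IHr].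
    elim=> [|s [h1 h2]].
      by split=> i; rewrite ?Gr0 ?G0s.
    split; last by move=> i; rewrite !G0s.
    by move=> i; rewrite GE /= !G0s /=; have := h1 i; have := h1 i.+1;
       case: i => [|i] /=; rewrite ?G0s; lia.
  have V s : hstrip (G r.+1 s) (G r.+1 s.+1).
    elim: s => [|s IHs] i.
      have [_ h] := IHr 0; have [h' _] := IHr 1.
      rewrite GE /=; rewrite !Gr0; have := h i; have := h i.+1; have := h' i.
      by case: i => [|i]; rewrite ?GE /rule /= ?Gr0; lia.
    rewrite (GE r s.+1) /=.
    have [h1 h2] := IHr s.+1; have [h3 h4] := IHr s.+2.
    move: (h1 i) (h2 i) (h1 i.+1) (h2 i.+1) => e1 e2 e3 e4.
    case: i e1 e2 e3 e4 => [|i] /= *; first by lia.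
    by have := h1 i; have := h2 i; lia.
  elim=> [|s [h1 h2]]; first by split; [move=> i; rewrite !Gr0 | exact: V].
  split; last exact: V.
  move=> i; rewrite (GE r.+1 s) /=.
  move: (h1 i) (V s i) (h1 i.+1) (V s i.+1) => e1 e2 e3 e4.
  case: i e1 e2 e3 e4 => [|i] /= *; first by lia.
  by have := h1 i; have := V s i; lia.
exists G; split.
- by move=> s i _; rewrite G0s.
- by move=> r i _; rewrite Gr0.
- move=> r s _ _; rewrite /cell GE /=; split=> // i.
  by have [h1 h2] := H r s; have := h1 i; have := h2 i; lia.
- by move=> r s _ _; have [] := H r s.
- by move=> r s _ _; have [] := H r s.
Qed.

(* Away from the last row and column the shapes are computed by running the
   local rule backwards from the corner [(R, S)]. *)
Lemma growth_exists_boundary (R S : nat) (y z : nat -> nat -> nat) :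
  (forall i, y 0 i = 0) -> (forall i, z 0 i = 0) ->
  (forall r, r < R -> hstrip (y r) (y r.+1)) ->
  (forall s, s < S -> hstrip (z s) (z s.+1)) ->
  (forall i, y R i = z S i) ->
  exists K G, [/\ growth R S K G, forall r i, r <= R -> G r S i = y r i &
                 forall s i, s <= S -> G R s i = z s i].
Proof.
move=> y0 z0 yh zh yz.
(* Backward form of [cell], where [x] is the corner nearest [(R, S)]. The recursion below is indexed
   by the distances to [(R, S)]. *)
pose rule (_ _ : nat) (x y z : nat -> nat) i :=
  minn (y i) (z i) + maxn (y i.+1) (z i.+1) - x i.+1.
(* At the corner [y R] replaces [z S]: the two agree only pointwise, and the recursion needs one and
   the same function there. *)
pose z' s := if s is 0 then y R else z (S - s).
have [B [B0s Br0 BE]] :=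
  @double_recursion _ z' (fun r => y (R - r)) rule (congr1 y (esym (subn0 R))).
have B0 s i : B 0 s i = z (S - s) i by rewrite B0s /z'; case: s; rewrite ?subn0.
have H r : r < R -> forall s, s <= S -> hstrip (B r.+1 s) (B r s) /\
      (s < S -> hstrip (B r s.+1) (B r s)).
  elim: r => [|r IHr] rR.
    have V s : s < S -> hstrip (B 0 s.+1) (B 0 s).
      by move=> sS i; rewrite !B0; have := zh (S - s.+1) ltac:(lia) i;
         have -> : (S - s.+1).+1 = S - s by lia.
    elim=> [|s IH] sS.
      split; last by move=> ?; exact: V.
      move=> i; rewrite !Br0; have := yh (R - 1) ltac:(lia) i.
      by have -> : (R - 1).+1 = R - 0 by lia.
    split; last by move=> ?; exact: V.
    have [h1 _] := IH ltac:(lia); have h2 := V s sS.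
    move=> i; rewrite (BE 0 s) /rule.
    by move: (h1 i) (h2 i) (h1 i.+1) (h2 i.+1); lia.
  have V s : s < S -> hstrip (B r.+1 s.+1) (B r.+1 s).
    move=> sS; have [h1 h2] := IHr ltac:(lia) s ltac:(lia).
    have {}h2 := h2 sS => i; rewrite (BE r s) /rule.
    by move: (h1 i) (h2 i) (h1 i.+1) (h2 i.+1); lia.
  elim=> [|s IH] sS.
    split; last by move=> ?; exact: V.
    move=> i; rewrite !Br0; have := yh (R - r.+2) ltac:(lia) i.
    by have -> : (R - r.+2).+1 = R - r.+1 by lia.
  split; last by move=> ?; exact: V.
  have [h1 _] := IH ltac:(lia); have h2 := V s sS.
  move=> i; rewrite (BE r.+1 s) /rule.
  by move: (h1 i) (h2 i) (h1 i.+1) (h2 i.+1); lia.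
pose G r s := B (R - r) (S - s).
(* The equation of [cell] for the first parts, solved for the entry. *)
pose K r s := G r.+1 s.+1 0 - maxn (G r s.+1 0) (G r.+1 s 0).
have GS r i : r <= R -> G r S i = y r i.
  by move=> rR; rewrite /G subnn Br0 subKn.
have GR s i : s <= S -> G R s i = z s i.
  by move=> sS; rewrite /G subnn B0 subKn.
have hr r s : r < R -> s <= S -> hstrip (G r s) (G r.+1 s).
  move=> rR sS; have [h _] := H (R - r.+1) ltac:(lia) (S - s) ltac:(lia).
  by rewrite /G; move: h; have -> : (R - r.+1).+1 = R - r by lia.
have hc r s : r <= R -> s < S -> hstrip (G r s) (G r s.+1).
  move=> rR sS; case: (ltngtP r R) rR => // [rR|->] _; last first.
    by move=> i; rewrite !GR; try lia; apply: zh.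
  (* [H] does not reach the horizontal edges of row [0], so for [r < R] they are derived from row
     [r.+1] by the backward rule. *)
  have [_ h] := H (R - r.+1) ltac:(lia) (S - s.+1) ltac:(lia).
  case: (posnP (R - r)) => [|_]; first by lia.
  have [h1 _] := H (R - r.+1) ltac:(lia) (S - s) ltac:(lia).
  have [h2 _] := H (R - r.+1) ltac:(lia) (S - s.+1) ltac:(lia).
  have {}h := h ltac:(lia); move: h h1 h2; rewrite /G.
  have -> : (S - s.+1).+1 = S - s by lia.
  have -> : (R - r.+1).+1 = R - r by lia.
  move=> h h1 h2 i.
  have := BE (R - r.+1) (S - s.+1); have -> : (S - s.+1).+1 = S - s by lia.
  have -> : (R - r.+1).+1 = R - r by lia.
  move=> ->; rewrite /rule.
  by move: (h i) (h2 i) (h i.+1) (h2 i.+1); lia.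
exists K, G; split=> //; split=> //.
(* The backward recursion ends in empty borders: row [0] grows by strips up to [G 0 S], which is
   [y 0], hence zero. Column [0] is alike. *)
- move=> s i sS; have : G 0 s i <= G 0 S i.
    by apply: (@hstrip_chain_le S (G 0) i _ s S) => // *; apply: hc.
  by rewrite GS // y0; lia.
- move=> r i rR; have : G r 0 i <= G R 0 i.
    by apply: (@hstrip_chain_le R (fun r => G r 0) i _ r R) => // *; apply: hr.
  by rewrite GR // z0; lia.
- move=> r s rR sS; split=> [|i].
    rewrite /K; have := hr r s.+1 rR sS 0; have := hc r.+1 s rR sS 0; lia.
  have := hr r s.+1 rR sS; have := hc r.+1 s rR sS.
  have E : G r s i = minn (G r s.+1 i) (G r.+1 s i)
      + maxn (G r s.+1 i.+1) (G r.+1 s i.+1) - G r.+1 s.+1 i.+1.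
    have := BE (R - r.+1) (S - s.+1); rewrite /G.
    have -> : (S - s.+1).+1 = S - s by lia.
    have -> : (R - r.+1).+1 = R - r by lia.
    by move=> ->; rewrite /rule minnC maxnC.
  by rewrite E => h1 h2; move: (h1 i) (h2 i) (h1 i.+1) (h2 i.+1); lia.
Qed.

(** * Uniqueness, sizes and symmetry of growth diagrams *)

(** Starting from the empty borders, the local rule determines each corner [x] from [w], [y], [z]
    and the entry. *)
Lemma growth_unique R S K K' G G' :
  growth R S K G -> growth R S K' G' ->
  (forall r s, r < R -> s < S -> K r s = K' r s) ->
  forall r s i, r <= R -> s <= S -> G r s i = G' r s i.
Proof.
move=> [G0 G1 G2 _ _] [G0' G1' G2' _ _] KK.
elim=> [|r IHr]; first by move=> *; rewrite G0 ?G0'.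
elim=> [|s IHs] i rR sS; first by rewrite G1 ?G1'.
have [c0 c] := G2 r s rR sS; have [c0' c'] := G2' r s rR sS.
case: i => [|i].
  by rewrite c0 c0' KK // IHr ?IHs //; lia.
by have := c i; have := c' i; rewrite !IHr ?IHs; try lia.
Qed.

(** The local rule also determines [w] from [x], [y], [z], so induction on the distance to [(R, S)]
    identifies the diagrams; the first parts then give the entries. *)
Lemma growth_unique_boundary R S K K' G G' :
  growth R S K G -> growth R S K' G' ->
  (forall r i, r <= R -> G r S i = G' r S i) ->
  (forall s i, s <= S -> G R s i = G' R s i) ->
  forall r s, r < R -> s < S -> K r s = K' r s.
Proof.
move=> [_ _ G2 _ _] [_ _ G2' _ _] eS eR.
have E r' : forall s' i, r' <= R -> s' <= S ->
    G (R - r') (S - s') i = G' (R - r') (S - s') i.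
  elim: r' => [|r' IHr]; first by move=> s' i _ _; rewrite subn0 eR //; lia.
  elim=> [|s' IHs] i rR sS; first by rewrite subn0 eS //; lia.
  have [_ c] := G2 (R - r'.+1) (S - s'.+1) ltac:(lia) ltac:(lia).
  have [_ c'] := G2' (R - r'.+1) (S - s'.+1) ltac:(lia) ltac:(lia).
  move: (c i) (c' i).
  have -> : (S - s'.+1).+1 = S - s' by lia.
  have -> : (R - r'.+1).+1 = R - r' by lia.
  by rewrite !IHr ?IHs; lia.
have {}E r s i : r <= R -> s <= S -> G r s i = G' r s i.
  by move=> rR sS; have := E (R - r) (S - s) i ltac:(lia) ltac:(lia);
     rewrite !subKn.
move=> r s rR sS; have [c _] := G2 r s rR sS; have [c' _] := G2' r s rR sS.
by move: c c'; rewrite !E; lia.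
Qed.

(** Since [minn a b + maxn a b = a + b], summing the local rule over the parts yields the sizes. *)
Lemma cell_weight N k w y z x :
  cell k w y z x -> x N = 0 -> y N = 0 -> z N = 0 ->
  weight N x + weight N w = weight N y + weight N z + k.
Proof.
move=> [c0 c] xN yN zN.
(* The index of [x] is one ahead of that of [w], which leaves the term [maxn (y M) (z M)]; it
   vanishes at [M = N]. *)
have E M : weight M.+1 x + weight M w =
    weight M y + weight M z + k + maxn (y M) (z M).
  elim: M => [|M IH]; first by rewrite weightS /weight !big_ord0; lia.
  by move: (c M); rewrite weightS (weightS _ w) (weightS _ y) (weightS _ z); lia.
by have := E N; rewrite weightS; lia.
Qed.

(** Adding up [cell_weight] along row [r] turns sums of entries into size increments. At most
    [R <= N] parts are nonzero, so [weight N] is the size. *)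
Lemma growth_row_weight N R S K G r : growth R S K G -> R <= N -> r < R ->
  forall s, s <= S -> weight N (G r.+1 s) = weight N (G r s) + weight s (K r).
Proof.
move=> [G0 G1 G2 G3 G4] RN rR.
have supp r' s : r' <= R -> s <= S -> G r' s N = 0.
  move=> r'R sS; apply: (@hstrip_support R (fun r => G r s)) => //; try lia.
  - by move=> i; rewrite G0.
  - by move=> *; apply: G3.
elim=> [|s IH] sS.
  rewrite {3}/weight big_ord0 addn0 /weight; apply: eq_bigr => i _.
  by rewrite !G1 //; lia.
have := cell_weight (G2 r s rR sS) (supp r.+1 s.+1 ltac:(lia) ltac:(lia))
  (supp r s.+1 ltac:(lia) ltac:(lia)) (supp r.+1 s ltac:(lia) ltac:(lia)).
by rewrite weightS IH; lia.
Qed.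

(** The local rule is symmetric in [y] and [z]. Statements about columns thus follow from those
    about rows. *)
Lemma growth_transpose R S K G : growth R S K G ->
  growth S R (fun s r => K r s) (fun s r => G r s).
Proof.
move=> [G0 G1 G2 G3 G4]; split; [by move=> *; apply: G1 | by move=> *; apply: G0
  | | by move=> *; apply: G4 | by move=> *; apply: G3].
move=> s r sS rR; have [c0 c] := G2 r s rR sS.
by split=> [|i]; [rewrite c0 | rewrite c]; lia.
Qed.

(** * Partitions as decreasing functions *)

Definition height (N : nat) (f : nat -> nat) : nat :=
  count (fun i => 0 < f i) (iota 0 N).

Definition parts (N : nat) (f : nat -> nat) : seq nat := mkseq f (height N f).

Lemma anti_le (f : nat -> nat) i j :
  (forall i, f i.+1 <= f i) -> i <= j -> f j <= f i.
Proof.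
move=> fa; elim: j => [|j IH] ij; first by have -> : i = 0 by lia.
case: (ltngtP i j.+1) ij => // [ij|->] _ //.
by have := fa j; have := IH ij; lia.
Qed.

Lemma height_le N f : height N f <= N.
Proof. by rewrite /height -{2}(size_iota 0 N) count_size. Qed.

(** The positive values of a decreasing function form an initial segment, so their number is the
    position of the first zero. *)
Lemma ltn_height N f i : (forall i, f i.+1 <= f i) ->
  (forall i, N <= i -> f i = 0) -> (i < height N f) = (0 < f i).
Proof.
move=> fa fN.
case: (ltnP i N) => [iN|Ni]; last by have := height_le N f; rewrite fN //; lia.
elim: N {fN} iN => // N IH iN.
have E : height N.+1 f = height N f + (0 < f N).
  by rewrite /height -[N.+1]addn1 iotaD count_cat /= addn0.
case: (posnP (f N)) => fN.
  rewrite E fN addn0; have [iN'|->] : i < N \/ i = N by lia.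
    exact: IH.
  by have := height_le N f; rewrite fN; lia.
have -> : height N.+1 f = N.+1.
  rewrite /height; set a := (fun i : nat => _).
  have : all a (iota 0 N.+1).
    apply/allP => j; rewrite mem_iota /a => jN.
    by have := anti_le (i := j) (j := N) fa ltac:(lia); lia.
  by rewrite all_count size_iota => /eqP.
by rewrite iN; have := anti_le (i := i) (j := N) fa ltac:(lia); lia.
Qed.

Lemma nth_parts N f i : (forall i, f i.+1 <= f i) ->
  (forall i, N <= i -> f i = 0) -> nth 0 (parts N f) i = f i.
Proof.
move=> fa fN; rewrite /parts; case: (ltnP i (height N f)) => iN.
  by rewrite nth_mkseq.
rewrite nth_default ?size_mkseq //.
by have := ltn_height i fa fN; lia.
Qed.

Lemma sumn_parts N f : (forall i, f i.+1 <= f i) ->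
  (forall i, N <= i -> f i = 0) -> sumn (parts N f) = weight N f.
Proof.
move=> fa fN; rewrite sumn_mkseq (weight_support (height_le N f)) // => i.
by have := ltn_height i fa fN; lia.
Qed.

Lemma parts_partition N f : (forall i, f i.+1 <= f i) ->
  (forall i, N <= i -> f i = 0) -> is_partition (parts N f).
Proof.
move=> fa fN; apply/andP; split.
  apply/(all_nthP 0) => i; rewrite size_mkseq => iN; rewrite nth_mkseq //.
  by rewrite -(ltn_height i fa fN).
apply/(sortedP 0) => i; rewrite size_mkseq => iN.
by rewrite !nth_mkseq //; try lia; apply: fa.
Qed.

Lemma partition_nth_anti s i : is_partition s -> nth 0 s i.+1 <= nth 0 s i.
Proof.
move=> /andP [_ /(sortedP 0) h]; case: (ltnP i.+1 (size s)) => is_.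
  exact: h.
by rewrite [nth 0 s i.+1]nth_default.
Qed.

Lemma partition_nth_gt0 s i : is_partition s -> (0 < nth 0 s i) = (i < size s).
Proof.
move=> /andP [/(all_nthP 0) h _]; case: (ltnP i (size s)) => is_.
  by rewrite h.
by rewrite nth_default.
Qed.

(** Parts are positive, so the length can be read off from the sequence padded with zeros. *)
Lemma eq_partition s t : is_partition s -> is_partition t ->
  (forall i, nth 0 s i = nth 0 t i) -> s = t.
Proof.
move=> ps pt st.
have E i : (i < size s) = (i < size t) by rewrite -!partition_nth_gt0 // st.
apply: (@eq_from_nth _ 0) => [|i _]; last exact: st.
by have := E (size s); have := E (size t); lia.
Qed.

(** * Matrices decorated with partitions *)

(** Prepending [a] makes [a - eta_1] the difference number [0]; the default [0] makes the last part
    a difference too, so that the total is [a]. *)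
Definition diffs (a : nat) (eta : seq nat) (c : nat) : nat :=
  nth 0 (a :: eta) c - nth 0 (a :: eta) c.+1.

Definition bounded_partition (d a : nat) (eta : seq nat) : Prop :=
  [/\ is_partition eta, all (fun x => x <= a) eta & size eta <= d.-1].

Lemma weight_diffs d a eta c : bounded_partition d a eta ->
  weight c (diffs a eta) + nth 0 (a :: eta) c = a.
Proof.
move=> [pe /(all_nthP 0) ea _]; elim: c => [|c IH]; first by rewrite /weight big_ord0.
have : nth 0 (a :: eta) c.+1 <= nth 0 (a :: eta) c.
  case: c {IH} => [|c] /=; last exact: partition_nth_anti.
  by case: (ltnP 0 (size eta)) => h; [apply: ea | rewrite nth_default].
by rewrite weightS [diffs a eta c]/diffs; lia.
Qed.

Lemma diffs_eq0 d a eta c : 0 < d -> bounded_partition d a eta -> d <= c ->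
  diffs a eta c = 0.
Proof.
move=> d0 [_ _ se] dc; rewrite /diffs nth_default //=; first lia.
Qed.

Lemma weight_diffs_full d l a eta : 0 < d -> bounded_partition d a eta -> d <= l ->
  weight l (diffs a eta) = a.
Proof.
move=> d0 be dl; have := weight_diffs l be; rewrite nth_default /=; first lia.
by case: be => _ _; lia.
Qed.

(** The differences sum to [a], and subtracting their partial sums from [a] gives the parts. *)
Lemma diffs_inj d l a eta a' eta' : 0 < d -> d <= l ->
  bounded_partition d a eta -> bounded_partition d a' eta' ->
  (forall c, c < l -> diffs a eta c = diffs a' eta' c) -> a = a' /\ eta = eta'.
Proof.
move=> d0 dl be be' E.
have Ea : a = a'.
  by rewrite -(weight_diffs_full d0 be dl) -(weight_diffs_full d0 be' dl); apply: eq_weight.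
split=> //; case: (be) (be') => pe _ se [pe' _ se'].
apply: eq_partition => // i; case: (ltnP i l) => il; last by rewrite !nth_default //; lia.
have := weight_diffs i.+1 be; have := weight_diffs i.+1 be'.
have -> : weight i.+1 (diffs a eta) = weight i.+1 (diffs a' eta').
  by apply: eq_weight => c ci; apply: E; lia.
by rewrite /=; lia.
Qed.

Lemma diffs_surj d k : 0 < d -> (forall c, d <= c -> k c = 0) ->
  exists2 eta, bounded_partition d (weight d k) eta &
    forall c, diffs (weight d k) eta c = k c.
Proof.
(* The parts are the tail sums [k (c+1) + ... + k (d-1)], the inverse of taking differences. *)
move=> d0 k0; pose f c := weight d k - weight c.+1 k.
have fa i : f i.+1 <= f i by rewrite /f (weightS i.+1); lia.
have f0 i : d.-1 <= i -> f i = 0.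
  by move=> di; rewrite /f; have := @leq_weight d i.+1 k ltac:(lia); lia.
exists (parts d.-1 f) => [|c].
  split; first exact: parts_partition; last by rewrite size_mkseq height_le.
  apply/(all_nthP 0) => i _; rewrite nth_parts // /f; lia.
have E i : nth 0 (weight d k :: parts d.-1 f) i = weight d k - weight i k.
  case: i => [|i] /=; first by rewrite {3}/weight big_ord0 subn0.
  by rewrite nth_parts.
rewrite /diffs !E weightS; case: (ltnP c d) => cd; last by rewrite k0 //; lia.
by have := @leq_weight c.+1 d k cd; rewrite weightS; lia.
Qed.

(* Blocks are numbered from 1 and components from 0: symbols of block [block mu r]
   are allowed in component [c] exactly when [c < block mu r]. *)
Definition block (mu : seq (seq nat)) (r : nat) : nat := (nth (0, 0) (idx mu) r).1.
Definition psize (mu : seq (seq nat)) (r : nat) : nat :=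
  part mu (nth (0, 0) (idx mu) r).1 (nth (0, 0) (idx mu) r).2.

Lemma mem_idx mu p i : ((p, i) \in idx mu) =
  [&& 0 < p, p <= size mu, 0 < i & i <= size (nth [::] mu p.-1)].
Proof.
apply/flattenP/idP => [[s /mapP [q qmu ->] /mapP [j jq [-> ->]]]|].
  by move: qmu jq; rewrite !mem_iota; lia.
move=> /and4P [p0 pmu i0 imu].
exists [seq (p, i) | i <- iota 1 (size (nth [::] mu p.-1))].
  by apply/mapP; exists p => //; rewrite mem_iota; lia.
by apply/mapP; exists i => //; rewrite mem_iota; lia.
Qed.

Lemma block_bounds mu r : r < size (idx mu) -> 0 < block mu r <= size mu.
Proof.
move=> /(mem_nth (0, 0)); rewrite /block; case: (nth _ _ _) => p i.
by rewrite mem_idx /= => /and4P [-> ->].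
Qed.

(** * Splitting a decorated matrix into [l] matrices *)

Definition kernel (AP : seq (seq nat) * seq (seq (seq nat))) (c r s : nat) : nat :=
  diffs (entry 0 AP.1 r s) (entry [::] AP.2 r s) c.

Lemma ParMatP nu mu A P : ParMat nu mu (A, P) <->
  [/\ size A = size (idx nu) /\
        (forall r, r < size (idx nu) -> size (nth [::] A r) = size (idx mu)),
      size P = size (idx nu) /\
        (forall r, r < size (idx nu) -> size (nth [::] P r) = size (idx mu)),
      forall r, r < size (idx nu) ->
        weight (size (idx mu)) (entry 0 A r) = psize nu r,
      forall s, s < size (idx mu) ->
        weight (size (idx nu)) (fun r => entry 0 A r s) = psize mu s &
      forall r s, r < size (idx nu) -> s < size (idx mu) ->
        bounded_partition (minn (block nu r) (block mu s))
          (entry 0 A r s) (entry [::] P r s)].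
Proof.
split.
  move=> [/= sA sA' rA cA [sP [sP' eP]]]; split=> //.
    by move=> r rR; rewrite /psize -rA // sumn_weight sA'.
  by move=> s sS; rewrite /psize -cA // sumn_mkseq.
move=> [[sA sA'] [sP sP'] rA cA eP]; split=> //=.
  by move=> r rR; rewrite sumn_weight sA' // -/(psize nu r) -rA.
by move=> s sS; rewrite -/(psize mu s) -cA // sumn_mkseq.
Qed.

(** Blocks are at most [l], so summing over [c < l] collects all differences of an entry and returns
    it; exchanging sums gives the margins. *)
Lemma kernel_spec l nu mu AP : size nu = l -> size mu = l -> ParMat nu mu AP ->
  [/\ forall c r s, r < size (idx nu) -> s < size (idx mu) ->
        minn (block nu r) (block mu s) <= c -> kernel AP c r s = 0,
      forall r, r < size (idx nu) ->
        weight l (fun c => weight (size (idx mu)) (kernel AP c r)) = psize nu r &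
      forall s, s < size (idx mu) ->
        weight l (fun c => weight (size (idx nu)) (fun r => kernel AP c r s))
        = psize mu s].
Proof.
case: AP => A P snu smu /ParMatP [_ _ rA cA eP].
have full r s : r < size (idx nu) -> s < size (idx mu) ->
    weight l (fun c => kernel (A, P) c r s) = entry 0 A r s.
  move=> rR sS; have := block_bounds rR; have := block_bounds sS => bs br.
  by apply: (weight_diffs_full _ (eP r s rR sS)); lia.
split.
- move=> c r s rR sS; have := block_bounds rR; have := block_bounds sS => bs br.
  by apply: diffs_eq0 (eP r s rR sS); lia.
- by move=> r rR; rewrite exchange_weight -rA //; apply: eq_weight => s sS; apply: full.
- by move=> s sS; rewrite exchange_weight -cA //; apply: eq_weight => r rR; apply: full.
Qed.

Lemma kernel_inj l nu mu x x' : size nu = l -> size mu = l ->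
  ParMat nu mu x -> ParMat nu mu x' ->
  (forall c r s, c < l -> r < size (idx nu) -> s < size (idx mu) ->
     kernel x c r s = kernel x' c r s) -> x = x'.
Proof.
case: x x' => [A P] [A' P'] snu smu /ParMatP [[sA sA'] [sP sP'] _ _ eP].
move=> /ParMatP [[tA tA'] [tP tP'] _ _ eP'] E.
have D r s : r < size (idx nu) -> s < size (idx mu) ->
   entry 0 A r s = entry 0 A' r s /\ entry [::] P r s = entry [::] P' r s.
  move=> rR sS; have := block_bounds rR; have := block_bounds sS => bs br.
  by apply: (diffs_inj _ _ (eP r s rR sS) (eP' r s rR sS) (l := l)) => [||c cl];
    [lia | lia | apply: E].
congr pair; apply: (@eq_from_nth _ [::]); rewrite ?sA ?tA ?sP ?tP // => r rR.
  apply: (@eq_from_nth _ 0); rewrite ?sA' ?tA' // => s sS.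
  by have [] := D r s rR sS.
apply: (@eq_from_nth _ [::]); rewrite ?sP' ?tP' // => s sS.
by have [] := D r s rR sS.
Qed.

Lemma kernel_surj l nu mu (K : nat -> nat -> nat -> nat) :
  size nu = l -> size mu = l ->
  (forall c r s, c < l -> r < size (idx nu) -> s < size (idx mu) ->
     minn (block nu r) (block mu s) <= c -> K c r s = 0) ->
  (forall r, r < size (idx nu) ->
     weight l (fun c => weight (size (idx mu)) (K c r)) = psize nu r) ->
  (forall s, s < size (idx mu) ->
     weight l (fun c => weight (size (idx nu)) (fun r => K c r s)) = psize mu s) ->
  exists2 x, ParMat nu mu x &
    forall c r s, c < l -> r < size (idx nu) -> s < size (idx mu) ->
      kernel x c r s = K c r s.
Proof.
move=> snu smu K0 Kr Kc.
(* [diffs_surj] asks for zeros at every [c] from the bound on, whereas [K] is controlled only for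
   [c < l]. *)
pose k r s c := if c < minn (block nu r) (block mu s) then K c r s else 0.
pose d r s := minn (block nu r) (block mu s).
have bounds r s : r < size (idx nu) -> s < size (idx mu) -> 0 < d r s <= l.
  by move=> rR sS; have := block_bounds rR; have := block_bounds sS; rewrite /d; lia.
have kK r s c : r < size (idx nu) -> s < size (idx mu) -> c < l -> k r s c = K c r s.
  by move=> rR sS cl; rewrite /k; case: ltnP => // h; rewrite K0.
have wk r s : r < size (idx nu) -> s < size (idx mu) ->
    weight (d r s) (k r s) = weight l (fun c => K c r s).
  move=> rR sS; rewrite -(eq_weight (f := k r s)); last by move=> c cl; apply: kK.
  have /andP [_ h] := bounds r s rR sS.
  elim: l h {snu smu K0 Kr Kc bounds kK} => [|l IH] h.
    by have -> : d r s = 0 by lia.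
  case: (ltngtP (d r s) l.+1) h => // [h|->] _ //.
  by rewrite weightS IH // /k ifN ?addn0 // -leqNgt.
(* The range conditions stand inside the existential, so that a partition can be chosen for all [r]
   and [s]. *)
have ex r s : exists eta, r < size (idx nu) -> s < size (idx mu) ->
    bounded_partition (d r s) (weight (d r s) (k r s)) eta /\
    forall c, diffs (weight (d r s) (k r s)) eta c = k r s c.
  case: (ltnP r (size (idx nu))) => rR; last by exists [::].
  case: (ltnP s (size (idx mu))) => sS; last by exists [::].
  have /andP [d0 _] := bounds r s rR sS.
  have [|eta h1 h2] := @diffs_surj (d r s) (k r s) d0.
    by move=> c dc; rewrite /k ifN // -leqNgt.
  by exists eta.
pose eta r s := epsilon (inhabits [::]) (fun eta => 
  r < size (idx nu) -> s < size (idx mu) ->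
    bounded_partition (d r s) (weight (d r s) (k r s)) eta /\
    forall c, diffs (weight (d r s) (k r s)) eta c = k r s c).
have etaP r s : r < size (idx nu) -> s < size (idx mu) ->
    bounded_partition (d r s) (weight (d r s) (k r s)) (eta r s) /\
    forall c, diffs (weight (d r s) (k r s)) (eta r s) c = k r s c.
  by have := epsilon_spec (inhabits [::]) _ (ex r s).
pose A := mkseq (fun r => mkseq (fun s => weight (d r s) (k r s)) (size (idx mu)))
  (size (idx nu)).
pose P := mkseq (fun r => mkseq (eta r) (size (idx mu))) (size (idx nu)).
have AE r s : r < size (idx nu) -> s < size (idx mu) ->
    entry 0 A r s = weight (d r s) (k r s).
  by move=> rR sS; rewrite /entry !nth_mkseq.
have PE r s : r < size (idx nu) -> s < size (idx mu) -> entry [::] P r s = eta r s.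
  by move=> rR sS; rewrite /entry !nth_mkseq.
exists (A, P); last first.
  move=> c r s cl rR sS; rewrite /kernel /= AE // PE // -kK //.
  by have [_ ->] := etaP r s rR sS.
apply/ParMatP; split.
- by split=> [|r rR]; rewrite ?size_mkseq // nth_mkseq // size_mkseq.
- by split=> [|r rR]; rewrite ?size_mkseq // nth_mkseq // size_mkseq.
- move=> r rR; rewrite -Kr // exchange_weight; apply: eq_weight => s sS.
  by rewrite AE // wk.
- move=> s sS; rewrite -Kc // exchange_weight; apply: eq_weight => r rR.
  by rewrite AE // wk.
- by move=> r s rR sS; rewrite AE // PE //; have [] := etaP r s rR sS.
Qed.

(** * Symbols and their ranks *)

(** The symbol [i_p] is the pair [(i, p)], hence the swap. Symbols thus sit at the positions of the
    matrix rows or columns they label, in increasing order. *)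
Definition symbols (mu : seq (seq nat)) : seq (nat * nat) :=
  [seq (x.2, x.1) | x <- idx mu].

Definition rank (mu : seq (seq nat)) (x : nat * nat) : nat := index x (symbols mu).

Lemma size_symbols mu : size (symbols mu) = size (idx mu).
Proof. exact: size_map. Qed.

Lemma nth_symbols mu r : r < size (idx mu) ->
  nth (0, 0) (symbols mu) r = ((nth (0, 0) (idx mu) r).2, block mu r).
Proof. by move=> rn; rewrite (nth_map (0, 0)). Qed.

Lemma mem_symbols mu x : (x \in symbols mu) =
  [&& 0 < x.2, x.2 <= size mu, 0 < x.1 & x.1 <= size (nth [::] mu x.2.-1)].
Proof.
case: x => i p /=; rewrite -mem_idx; apply/mapP/idP => [[[q j] h [-> ->]] //|h].
by exists (p, i).
Qed.

Lemma mult_notin mu x : x \notin symbols mu -> mult mu x = 0.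
Proof.
rewrite mem_symbols /mult /part; case: ifP => // /andP [-> ->] /=.
rewrite negb_and -!ltnNge => /orP [h|h]; last by rewrite nth_default //; lia.
by rewrite (nth_default [::]) ?nth_nil //; lia.
Qed.

Lemma mult_symbol mu r : r < size (idx mu) ->
  mult mu (nth (0, 0) (symbols mu) r) = psize mu r.
Proof.
move=> rn; have := mem_nth (0, 0) rn; rewrite nth_symbols // /mult /psize /block.
by case: (nth _ _ _) => p i; rewrite mem_idx /= => /and4P [-> _ -> _].
Qed.

Lemma sym_lt_trans : transitive sym_lt.
Proof. by move=> [a b] [c d] [e f]; rewrite /sym_lt /=; lia. Qed.

Lemma sym_lt_irr : irreflexive sym_lt.
Proof. by move=> [a b]; rewrite /sym_lt /=; lia. Qed.

Lemma sym_lt_asym x y : sym_lt x y -> sym_le y x -> False.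
Proof.
case: x y => [a b] [c d]; rewrite /sym_le /sym_lt xpair_eqE /=; lia.
Qed.

Lemma symbols_pairwise mu : pairwise sym_lt (symbols mu).
Proof.
(* Generalised to blocks numbered from [a], because the tail of the list starts one block later. *)
suff H L a : pairwise sym_lt [seq (x.2, x.1) | x <- flatten
    [seq [seq (p, i) | i <- iota 1 (size (nth [::] mu p.-1))] | p <- iota a L]].
  exact: H.
elim: L a => [|L IH] a //=.
rewrite map_cat pairwise_cat IH andbT; apply/andP; split.
  apply/allrelP => x y /mapP [x' /mapP [i _ ->] ->] /mapP [y' /flattenP [s]].
  move=> /mapP [p]; rewrite mem_iota => h -> /mapP [j _ ->] ->.
  by rewrite /sym_lt /=; lia.
rewrite -map_comp pairwise_map; move: (size _) => k.
have := iota_ltn_sorted 1 k; rewrite (sorted_pairwise ltn_trans).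
by apply: sub_pairwise => i j ij; rewrite /sym_lt /= eqxx ij orbT.
Qed.

Lemma symbols_uniq mu : uniq (symbols mu).
Proof.
apply: (sorted_uniq sym_lt_trans sym_lt_irr).
by rewrite (sorted_pairwise sym_lt_trans) symbols_pairwise.
Qed.

Lemma nth_symbols_lt mu r r' : r < r' -> r' < size (idx mu) ->
  sym_lt (nth (0, 0) (symbols mu) r) (nth (0, 0) (symbols mu) r').
Proof.
move=> rr rn; have /(pairwiseP (0, 0)) h := symbols_pairwise mu.
by apply: h => //; rewrite inE size_symbols; lia.
Qed.

Lemma nth_symbols_le mu r r' : r <= r' -> r' < size (idx mu) ->
  sym_le (nth (0, 0) (symbols mu) r) (nth (0, 0) (symbols mu) r').
Proof.
rewrite /sym_le leq_eqVlt => /orP [/eqP -> _|rr rn]; first by rewrite eqxx.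
by rewrite nth_symbols_lt ?orbT.
Qed.

Lemma rank_lt mu x y : x \in symbols mu -> y \in symbols mu ->
  sym_lt x y -> rank mu x < rank mu y.
Proof.
move=> xX yX xy; rewrite ltnNge; apply/negP => h.
apply: (sym_lt_asym xy); rewrite -(nth_index (0, 0) xX) -(nth_index (0, 0) yX).
by apply: nth_symbols_le; rewrite // -size_symbols index_mem.
Qed.

Lemma rank_le mu x y : x \in symbols mu -> y \in symbols mu ->
  sym_le x y -> rank mu x <= rank mu y.
Proof. by move=> xX yX /orP [/eqP -> //|h]; apply/ltnW/rank_lt. Qed.

Lemma rank_nth mu r : r < size (idx mu) -> rank mu (nth (0, 0) (symbols mu) r) = r.
Proof. by move=> rn; rewrite /rank index_uniq ?symbols_uniq // size_symbols. Qed.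

Lemma rank_bound mu x : (rank mu x < size (idx mu)) = (x \in symbols mu).
Proof. by rewrite -size_symbols index_mem. Qed.

(** Only the [r]-th symbol has rank [r]. Multiplicities are thereby increments of the counts that
    define a chain. *)
Lemma count_rankS mu r s : r < size (idx mu) ->
  count (fun x => rank mu x < r.+1) s =
  count (fun x => rank mu x < r) s + count_mem (nth (0, 0) (symbols mu) r) s.
Proof.
move=> rn; elim: s => //= x s ->.
have -> : (x == nth (0, 0) (symbols mu) r) = (rank mu x == r).
  apply/eqP/eqP => [->|h]; first exact: rank_nth.
  by rewrite -h nth_index // -rank_bound h.
by lia.
Qed.

Lemma weight_psize mu : weight (size (idx mu)) (psize mu) = sumn (map sumn mu).
Proof.
have -> : weight (size (idx mu)) (psize mu) =
    sumn [seq part mu x.1 x.2 | x <- idx mu].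
  rewrite sumn_weight size_map; apply: eq_weight => r rn.
  by rewrite (nth_map (0, 0)).
rewrite /idx map_flatten sumn_flatten -!map_comp.
(* Blocks and their parts are numbered from 1, sums from 0; [iotaDl] makes the shift. *)
rewrite -[1]addn0 iotaDl -map_comp sumn_weight size_map size_iota.
rewrite sumn_weight size_map; apply: eq_weight => p pmu.
rewrite (nth_map 0) ?size_iota // nth_iota // (nth_map [::]) //= -map_comp.
rewrite iotaDl -map_comp sumn_weight size_map size_iota sumn_weight.
by apply: eq_weight => i ip; rewrite (nth_map 0) ?size_iota // nth_iota.
Qed.

(** * Tableaux and chains of partitions *)

(** For a semistandard [T], the length of row [i] of the subtableau formed by the first [r]
    symbols. *)
Definition row_count (mu : seq (seq nat)) (T : tableau) (c r i : nat) : nat :=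
  count (fun x => rank mu x < r) (nth [::] (nth [::] T c) i).

(** Semistandard multitableaux of type [mu] as chains: strips express the row and column conditions,
    constancy the condition on components, and the growth of the total size the type. *)
Definition chain (mu : seq (seq nat)) (l N : nat) (y : nat -> nat -> nat -> nat) : Prop :=
  [/\ forall c i, c < l -> y c 0 i = 0,
      forall c r, c < l -> r < size (idx mu) -> hstrip (y c r) (y c r.+1),
      forall c r i, c < l -> r < size (idx mu) -> block mu r <= c ->
        y c r.+1 i = y c r i &
      forall r, r < size (idx mu) ->
        weight l (fun c => weight N (y c r.+1))
        = psize mu r + weight l (fun c => weight N (y c r))].

Lemma sorted_count_lt (s : seq nat) r j : sorted leq s -> j < size s ->
  (nth 0 s j < r) = (j < count (fun x => x < r) s).
Proof.
elim: s j => // a s IH j /= pa js.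
case: (ltnP a r) => ar.
  by case: j js => [|j] js //=; rewrite add1n ltnS; apply: IH (path_sorted pa) _.
have /allP h := order_path_min leq_trans pa.
have -> : count (fun x => x < r) s = 0.
  by apply/eqP; rewrite -leqn0 leqNgt -has_count; apply/hasPn => x /h /=; lia.
apply/negbTE; rewrite -leqNgt; case: j js => [|j] js //=.
by apply: leq_trans ar _; apply: h _ (mem_nth 0 js).
Qed.

Lemma count_tableau a l N (T : tableau) : size T = l ->
  (forall c, c < l -> size (nth [::] T c) <= N) ->
  count a (flatten (flatten T)) =
  weight l (fun c => weight N (fun i => count a (nth [::] (nth [::] T c) i))).
Proof.
move=> <- h; rewrite count_flatten map_flatten sumn_flatten -map_comp sumn_weight.
rewrite size_map; apply: eq_weight => c cT; rewrite (nth_map [::]) //=.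
rewrite sumn_weight size_map.
rewrite (eq_weight (g := fun i => count a (nth [::] (nth [::] T c) i))); last first.
  by move=> i ic; rewrite (nth_map [::]).
have := h c cT; elim: N {h} => [|N IH] hN; first by have -> : size (nth [::] T c) = 0 by lia.
have [hN'|hN'] : size (nth [::] T c) <= N \/ size (nth [::] T c) = N.+1 by lia.
  by rewrite weightS -IH // [nth [::] (nth [::] T c) N]nth_default //= addn0.
by rewrite -hN'.
Qed.

Lemma mem_row (T : tableau) c i x :
  x \in nth [::] (nth [::] T c) i -> x \in flatten (nth [::] T c).
Proof.
move=> xr; apply/flattenP; exists (nth [::] (nth [::] T c) i) => //.
by apply: mem_nth; rewrite ltnNge; apply/negP => h; rewrite nth_default in xr.
Qed.

Lemma mem_component (T : tableau) c x :
  x \in flatten (nth [::] T c) -> x \in flatten (flatten T).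
Proof.
move=> /flattenP [s sc xs]; apply/flattenP; exists s => //.
apply/flattenP; exists (nth [::] T c) => //.
by apply: mem_nth; rewrite ltnNge; apply/negP => h; rewrite nth_default in sc.
Qed.

Lemma SST_symbols lam mu T x : SST lam mu T -> x \in flatten (flatten T) ->
  x \in symbols mu.
Proof.
move=> [_ cT _ _ _] xT; apply/negPn/negP => /mult_notin; rewrite -cT.
by move=> /count_memPn; rewrite xT.
Qed.

Lemma SST_row_symbols lam mu T c i x : SST lam mu T ->
  x \in nth [::] (nth [::] T c) i -> x \in symbols mu.
Proof. by move=> sT /mem_row /mem_component; apply: SST_symbols sT. Qed.

Lemma SST_size_row lam mu T c i : SST lam mu T ->
  size (nth [::] (nth [::] T c) i) = nth 0 (nth [::] lam c) i.
Proof.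
move=> [<- _ _ _ _]; rewrite /Defs.shape.
case: (ltnP c (size T)) => cT; last by rewrite !(nth_default [::]) ?size_map ?nth_nil.
rewrite (nth_map [::]) //.
case: (ltnP i (size (nth [::] T c))) => ic; last first.
  by rewrite [nth [::] (nth [::] T c) i]nth_default // nth_default ?size_map.
by rewrite (nth_map [::]).
Qed.

Lemma SST_ranks_sorted lam mu T c i : SST lam mu T ->
  sorted leq [seq rank mu x | x <- nth [::] (nth [::] T c) i].
Proof.
move=> sT; case: (sT) => _ _ rT _ _.
apply/(sortedP 0) => j; rewrite size_map => js.
rewrite !(nth_map (0, 0)) //; last exact: ltnW.
apply: rank_le.
- by apply: (SST_row_symbols (c := c) (i := i) sT); apply/mem_nth/ltnW.
- by apply: (SST_row_symbols (c := c) (i := i) sT); apply: mem_nth.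
by have /(sortedP (0, 0)) := rT c i; apply.
Qed.

(** Ranks increase weakly along a row, so those below [r] fill its first [row_count mu T c r i]
    cells. *)
Lemma rank_entry_lt lam mu T c i j r : SST lam mu T ->
  j < size (nth [::] (nth [::] T c) i) ->
  (rank mu (tab_entry T c i j) < r) = (j < row_count mu T c r i).
Proof.
move=> sT js; have := sorted_count_lt r (SST_ranks_sorted c i sT).
by move=> /(_ j); rewrite size_map (nth_map (0, 0)) // count_map => ->.
Qed.

Lemma row_count_full lam mu T c i : SST lam mu T ->
  row_count mu T c (size (idx mu)) i = nth 0 (nth [::] lam c) i.
Proof.
move=> sT; rewrite -(SST_size_row c i sT) /row_count; apply/eqP; rewrite -all_count.
by apply/allP => x xr; rewrite rank_bound; apply: SST_row_symbols sT xr.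
Qed.

Lemma Par_component l m lam c : Par l m lam -> is_partition (nth [::] lam c).
Proof.
move=> [_ /(all_nthP [::]) h]; case: (ltnP c (size lam)) => cl; first exact: h.
by rewrite nth_default.
Qed.

Lemma row_count_chain l m lam mu T N : Par l m lam -> SST lam mu T ->
  size (idx mu) <= N -> chain mu l N (row_count mu T).
Proof.
move=> pl sT nN; case: (sT) => shT cT _ colT compT.
have sizeT : size T = l by case: pl => [[<- _] _]; rewrite -shT size_map.
have h0 c i : row_count mu T c 0 i = 0.
  by apply/eqP; rewrite -leqn0 leqNgt -has_count; apply/hasPn.
have hh c r : hstrip (row_count mu T c r) (row_count mu T c r.+1).
  move=> i; apply/andP; split; last by apply: sub_count => x /=; lia.
  (* Column [j] is the last one counted in row [i.+1] at step [r.+1]; the entry above it is strictly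
     smaller, so it is counted at step [r] already. *)
  case E : (row_count mu T c r.+1 i.+1) => [//|j].
  have js : j < size (nth [::] (nth [::] T c) i.+1).
    by rewrite -E; apply: count_size.
  have js' : j < size (nth [::] (nth [::] T c) i).
    move: js; rewrite !(SST_size_row _ _ sT).
    by have := partition_nth_anti i (Par_component c pl); lia.
  rewrite -(rank_entry_lt r sT js').
  have := rank_entry_lt r.+1 sT js; rewrite E ltnSn ltnS; apply: leq_trans.
  apply: rank_lt; last exact: colT.
    by apply: (SST_row_symbols (c := c) (i := i) sT); apply: mem_nth.
  by apply: (SST_row_symbols (c := c) (i := i.+1) sT); apply: mem_nth.
(* Each step creates at most one row, whereas a component with more than [N] rows would have a
   positive row [N]. *)
have rows c : size (nth [::] T c) <= N.
  rewrite leqNgt; apply/negP => h.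
  have := @hstrip_support (size (idx mu)) (row_count mu T c) (h0 c) (fun r _ => hh c r)
    (size (idx mu)) N ltac:(lia) nN.
  rewrite (row_count_full _ _ sT) => /eqP; rewrite -leqn0 leqNgt.
  rewrite (partition_nth_gt0 _ (Par_component c pl)) -shT /Defs.shape.
  case: (ltnP c (size T)) => cs; last by rewrite nth_default in h.
  by rewrite (nth_map [::]) // size_map h.
split=> // [c r i cl rn bc|r rn].
  (* Steps [r] and [r.+1] differ only by the symbol of rank [r], whose block is too small for
     component [c]. *)
  apply: eq_in_count => x xr; rewrite ltnS leq_eqVlt; case: eqP => //= rx.
  have xX := SST_row_symbols sT xr.
  have := compT c => /allP /(_ x (mem_row xr)).
  by rewrite -(nth_index (0, 0) xX) -/(rank mu x) rx nth_symbols //=; lia.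
rewrite -!(count_tableau _ sizeT (fun c _ => rows c)) count_rankS //.
by rewrite cT mult_symbol // addnC.
Qed.

(** The last step gives the shape, and [rank_entry_lt] recovers the rank of each entry from the step
    at which its cell appears. *)
Lemma row_count_inj l m lam lam' mu T T' : Par l m lam -> Par l m lam' ->
  SST lam mu T -> SST lam' mu T' ->
  (forall c r i, c < l -> r <= size (idx mu) -> row_count mu T c r i = row_count mu T' c r i) ->
  T = T'.
Proof.
move=> pl pl' sT sT' E.
have sz : size lam = l by case: pl => [[-> _] _].
have sz' : size lam' = l by case: pl' => [[-> _] _].
have El : lam = lam'.
  apply: (@eq_from_nth _ [::]) => [|c]; rewrite sz ?sz' // => cl.
  apply: eq_partition (Par_component c pl) (Par_component c pl') _ => i.
  by rewrite -(row_count_full _ _ sT) -(row_count_full _ _ sT') E.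
subst lam'; case: (sT) (sT') => shT _ _ _ _ [shT' _ _ _ _].
have szT : size T = l by rewrite -sz -shT size_map.
have szT' : size T' = l by rewrite -sz -shT' size_map.
apply: (@eq_from_nth _ [::]) => [|c]; rewrite szT ?szT' // => cl.
have Ec : size (nth [::] T c) = size (nth [::] T' c).
  have := congr1 (fun s => size (nth [::] s c)) (etrans shT (esym shT')).
  by rewrite /Defs.shape !(nth_map [::]) ?szT ?szT' // !size_map.
apply: (@eq_from_nth _ [::]) => // i _.
have Er : size (nth [::] (nth [::] T c) i) = size (nth [::] (nth [::] T' c) i).
  by rewrite (SST_size_row _ _ sT) (SST_size_row _ _ sT').
apply: (@eq_from_nth _ (0, 0)) => // j js.
have xX : tab_entry T c i j \in symbols mu.
  by apply: (SST_row_symbols (c := c) (i := i) sT); apply: mem_nth.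
have xX' : tab_entry T' c i j \in symbols mu.
  by apply: (SST_row_symbols (c := c) (i := i) sT'); apply: mem_nth; rewrite -Er.
rewrite -/(tab_entry T c i j) -/(tab_entry T' c i j).
rewrite -(nth_index (0, 0) xX) -(nth_index (0, 0) xX').
congr nth; rewrite -!/(rank _ _).
have D r : r <= size (idx mu) ->
    (rank mu (tab_entry T c i j) < r) = (rank mu (tab_entry T' c i j) < r).
  by move=> rn; rewrite (rank_entry_lt r sT) // (rank_entry_lt r sT') -?Er // E.
move: xX xX'; rewrite -!rank_bound => b b'.
have := D (rank mu (tab_entry T c i j)).+1 b.
by have := D (rank mu (tab_entry T' c i j)).+1 b'; lia.
Qed.

(** * The tableau of a chain *)

Section Chain.

Variables (mu : seq (seq nat)) (l N : nat) (y : nat -> nat -> nat -> nat).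
Hypotheses (ych : chain mu l N y) (nN : size (idx mu) <= N).
Let n := size (idx mu).

Lemma chain_support c r i : c < l -> r <= n -> N <= i -> y c r i = 0.
Proof.
case: ych => y0 yh _ _ cl rn Ni; apply: (@hstrip_support n (y c)) => //.
- by move=> j; apply: y0.
- by move=> r'; apply: yh.
- by rewrite /n in rn; lia.
Qed.

Lemma chain_anti c r i : c < l -> r <= n -> y c r i.+1 <= y c r i.
Proof.
case: ych => y0 yh _ _ cl; case: r => [|r] rn; first by rewrite !y0.
exact: hstrip_anti (yh c r cl rn).
Qed.

Lemma chain_mono c i r r' : c < l -> r <= r' -> r' <= n -> y c r i <= y c r' i.
Proof.
move=> cl; apply: hstrip_chain_le => r'' h.
by case: ych => _ yh _ _; apply: yh.
Qed.

Definition chain_shape : seq (seq nat) := mkseq (fun c => parts N (y c n)) l.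

Lemma chain_shape_Par m : Lambda_st l m mu -> Par l m chain_shape.
Proof.
move=> [_ [_ sm]]; have H : all is_partition chain_shape.
  apply/(all_nthP [::]) => c; rewrite size_mkseq => cl; rewrite nth_mkseq //.
  by apply: parts_partition => i; [apply: chain_anti | apply: chain_support].
split=> //; split; first exact: size_mkseq.
split; first by apply: sub_all H => s /andP [].
rewrite -sm -(weight_psize mu) sumn_weight size_map /chain_shape size_mkseq.
rewrite (eq_weight (g := fun c => weight N (y c n))); last first.
  move=> c cl; rewrite (nth_map [::]) ?size_mkseq // nth_mkseq // sumn_parts //.
    by move=> i; apply: chain_anti.
  by move=> i; apply: chain_support.
case: ych => y0 _ _ yw.
(* The total size at step [r] accumulates the first [r] multiplicities. *)
suff H' r : r <= n -> weight l (fun c => weight N (y c r)) = weight r (psize mu).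
  exact: H'.
elim: r => [|r IH] rn.
  rewrite [RHS]/weight big_ord0; apply: weight_eq0 => c cl.
  by apply: weight_eq0 => i _; apply: y0.
by rewrite yw // weightS IH; [rewrite addnC | apply: ltnW].
Qed.

(* Rank of the symbol in row [i], column [j] of component [c]: the first step of
   the chain at which this cell is present. *)
Definition chain_rank c i j : nat := count (fun r => y c r.+1 i <= j) (iota 0 n).

(** Row lengths grow with the step, so the steps at which a cell is absent form an initial segment.
    This is the counterpart of [rank_entry_lt]. *)
Lemma chain_rank_lt c i j r : c < l -> r <= n ->
  (chain_rank c i j < r) = (j < y c r i).
Proof.
case: r => [|r] cl rn; first by case: ych => -> //; rewrite !ltn0.
have srt : sorted leq (mkseq (fun r => y c r.+1 i) n).
  apply/(sortedP 0) => k; rewrite size_mkseq => kn.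
  by rewrite !nth_mkseq; try lia; apply: chain_mono.
have := @sorted_count_lt _ j.+1 r srt; rewrite size_mkseq nth_mkseq //.
by rewrite count_map /= => /(_ rn) h; rewrite !ltnS /chain_rank leqNgt -h -ltnNge.
Qed.

Definition chain_row c i : seq (nat * nat) :=
  mkseq (fun j => nth (0, 0) (symbols mu) (chain_rank c i j)) (y c n i).

(** Only the nonempty rows are listed, so that the shape consists of positive parts. *)
Definition chain_tableau : tableau :=
  mkseq (fun c => mkseq (chain_row c) (height N (y c n))) l.

Lemma nth_chain_tableau c i : c < l ->
  nth [::] (nth [::] chain_tableau c) i = chain_row c i.
Proof.
move=> cl; rewrite nth_mkseq //; case: (ltnP i (height N (y c n))) => ih.
  by rewrite nth_mkseq.
rewrite nth_default ?size_mkseq //.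
have := ltn_height (N := N) (f := y c n) i => /(_ _ _) h.
have yi : y c n i = 0.
  have := h (fun j => chain_anti j cl (leqnn n)) (fun j => chain_support cl (leqnn n)).
  by lia.
by rewrite /chain_row yi.
Qed.

Lemma chain_rank_bound c i j : c < l -> j < y c n i -> chain_rank c i j < n.
Proof. by move=> cl jy; rewrite chain_rank_lt. Qed.

Lemma row_count_chain_tableau c r i : c < l -> r <= n ->
  row_count mu chain_tableau c r i = y c r i.
Proof.
move=> cl rn; rewrite /row_count nth_chain_tableau // count_map.
rewrite (eq_in_count (a2 := fun j => j < y c r i)); last first.
  move=> j; rewrite mem_iota add0n /= => jy.
  by rewrite rank_nth ?chain_rank_lt //; apply: chain_rank_bound.
(* What remains is that exactly [a] of the numbers below [b] are below [a], given [a <= b]. *)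
have := chain_mono i cl rn (leqnn n); move: (y c n i) (y c r i) => b a.
elim: b => [|b IH] ab; first by rewrite /=; lia.
have [h|->] : a <= b \/ a = b.+1 by lia.
  by rewrite -[b.+1]addn1 iotaD count_cat IH //= add0n addn0; lia.
apply/eqP; rewrite -{3}(size_iota 0 b.+1) -all_count.
by apply/allP => j; rewrite mem_iota.
Qed.

Lemma shape_chain_tableau : Defs.shape chain_tableau = chain_shape.
Proof.
rewrite /Defs.shape /chain_tableau /chain_shape /mkseq -map_comp; apply: eq_map => c /=.
by rewrite /parts /mkseq -map_comp; apply: eq_map => i /=; rewrite size_map size_iota.
Qed.

Lemma chain_row_in c i x : c < l -> x \in chain_row c i ->
  exists2 j, j < y c n i & x = nth (0, 0) (symbols mu) (chain_rank c i j).
Proof.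
by move=> cl /mapP [j]; rewrite mem_iota add0n /= => h ->; exists j.
Qed.

Lemma chain_tableau_in c x : x \in flatten (nth [::] chain_tableau c) ->
  c < l /\ exists i, x \in chain_row c i.
Proof.
case: (ltnP c l) => cl; last by rewrite nth_default // size_mkseq.
rewrite nth_mkseq // => /flattenP [s /mapP [i _ ->] xs]; split=> //.
by exists i.
Qed.

Lemma chain_tableau_SST : SST chain_shape mu chain_tableau.
Proof.
have tail c i : l <= c -> nth [::] (nth [::] chain_tableau c) i = [::].
  move=> lc; rewrite [nth [::] chain_tableau c]nth_default ?nth_nil //.
  by rewrite size_mkseq.
split.
- exact: shape_chain_tableau.
- move=> x; case: (boolP (x \in symbols mu)) => xX; last first.
    rewrite mult_notin //; apply/count_memPn/negP => /flattenP [s].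
    move=> /flattenP [t /(nthP [::]) [c cl <-] sc xs].
    have [cl' [i xi]] : c < l /\ exists i, x \in chain_row c i.
      by apply: chain_tableau_in; apply/flattenP; exists s.
    have [j jy E] := chain_row_in cl' xi; move: xX.
    by rewrite -rank_bound E rank_nth; have -> := chain_rank_bound cl' jy.
  have rn : rank mu x < n by rewrite rank_bound.
  (* The multiplicity of [x] is the difference of two consecutive total sizes, which the chain
     prescribes. *)
  have := count_rankS (flatten (flatten chain_tableau)) rn.
  have hN c : c < l -> size (nth [::] chain_tableau c) <= N.
    by move=> cl; rewrite nth_mkseq // size_mkseq height_le.
  rewrite !(count_tableau _ (size_mkseq _ l) hN).
  have E r : r <= n ->
      weight l (fun c => weight N (row_count mu chain_tableau c r)) =
      weight l (fun c => weight N (y c r)).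
    move=> rn'; apply: eq_weight => c cl; apply: eq_weight => i _.
    exact: row_count_chain_tableau.
  have := E _ rn; rewrite /row_count => ->.
  have := E _ (ltnW rn); rewrite /row_count => ->.
  have [_ _ _ -> //] := ych.
  rewrite -(mult_symbol rn) addnC => /addnI.
  by rewrite /rank nth_index.
- move=> c i; case: (ltnP c l) => cl; last by rewrite tail.
  rewrite nth_chain_tableau //; apply/(sortedP (0, 0)) => j.
  rewrite size_mkseq => jy; rewrite !nth_mkseq //; last by lia.
  apply: nth_symbols_le; last exact: chain_rank_bound.
  (* A cell further right is absent for at least as many steps. *)
  by apply: sub_count => r /= h; lia.
- move=> c i j; case: (ltnP c l) => cl; last by rewrite tail.
  rewrite /tab_entry !nth_chain_tableau // size_mkseq => jy.
  have jy' : j < y c n i by have := chain_anti i cl (leqnn n); lia.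
  rewrite !nth_mkseq //; have rn := chain_rank_bound cl jy.
  apply: nth_symbols_lt => //; rewrite chain_rank_lt //; last exact: ltnW.
  (* When the lower cell has just appeared, the strip condition puts the cell above it in the
     preceding shape. *)
  have := ltnSn (chain_rank c i.+1 j); rewrite chain_rank_lt // => h.
  have [_ yh _ _] := ych; have := yh c _ cl rn i; lia.
- move=> c; apply/allP => x /chain_tableau_in [cl [i xi]].
  have [j jy ->] := chain_row_in cl xi.
  have rn := chain_rank_bound cl jy; rewrite nth_symbols //= ltnNge.
  (* Otherwise the cell would appear at a step that leaves component [c] unchanged. *)
  apply/negP => bc; have [_ _ yb _] := ych.
  have := ltnSn (chain_rank c i j); rewrite chain_rank_lt // yb //.
  by rewrite -chain_rank_lt ?ltnn // ltnW.
Qed.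

End Chain.

(** * The correspondence *)

(** Row sums become increments of size. A zero row adds nothing, and nested partitions of equal size
    coincide. *)
Lemma growth_chain nu l N S K G : size (idx nu) <= N ->
  (forall c, c < l -> growth (size (idx nu)) S (K c) (G c)) ->
  (forall c r s, c < l -> r < size (idx nu) -> s < S -> block nu r <= c -> K c r s = 0) ->
  (forall r, r < size (idx nu) -> weight l (fun c => weight S (K c r)) = psize nu r) ->
  chain nu l N (fun c r => G c r S).
Proof.
move=> nN gG K0 Kw; split.
- by move=> c i /gG [G0 _ _ _ _]; rewrite G0.
- by move=> c r /gG [_ _ _ G3 _] rn; apply: G3.
- move=> c r i cl rn bc; have g := gG c cl; have [_ _ _ G3 _] := g.
  (* The bound must exceed [i] for the comparison of sizes to reach part [i]. *)
  have := growth_row_weight (N := maxn (size (idx nu)) i.+1) g (leq_maxl _ _) rn (leqnn S).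
  rewrite [weight S _]weight_eq0 ?addn0; last by move=> s sS; apply: K0.
  move=> E; apply: (weight_le_eq _ E); last by lia.
  by move=> j; have := G3 r S rn (leqnn S) j => /andP [].
- move=> r rn; rewrite -Kw // -weightD; apply: eq_weight => c cl.
  by rewrite (growth_row_weight (gG c cl) nN rn (leqnn S)) addnC.
Qed.

(** Size increments give back the row sums; where the partition does not change, the row sum and
    hence every entry of the row is zero. *)
Lemma chain_growth nu l N S K G y : size (idx nu) <= N -> chain nu l N y ->
  (forall c, c < l -> growth (size (idx nu)) S (K c) (G c)) ->
  (forall c r i, c < l -> r <= size (idx nu) -> G c r S i = y c r i) ->
  (forall c r s, c < l -> r < size (idx nu) -> s < S -> block nu r <= c -> K c r s = 0) /\
  (forall r, r < size (idx nu) -> weight l (fun c => weight S (K c r)) = psize nu r).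
Proof.
move=> nN [_ _ yb yw] gG Gy.
have E c r : c < l -> r < size (idx nu) ->
    weight N (y c r.+1) = weight N (y c r) + weight S (K c r).
  move=> cl rn; have := growth_row_weight (gG c cl) nN rn (leqnn S).
  rewrite (eq_weight (g := y c r.+1)); last by move=> i _; apply: Gy.
  by rewrite [weight N (G c r S)](eq_weight (g := y c r)) // => i _; apply/Gy/ltnW.
split=> [c r s cl rn sS bc|r rn].
  apply: (weight_eq0P _ sS); have := E c r cl rn.
  by rewrite (eq_weight (g := y c r)); [lia | move=> i _; apply: yb].
have := yw r rn; rewrite (eq_weight (g := fun c => weight N (y c r) + weight S (K c r))).
  by rewrite weightD; lia.
by move=> c cl; apply: E.
Qed.

(** One growth diagram per component, with the first tableau along the last column and the second
    along the last row. As a relation it can be read in both directions. *)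
Definition RSK_rel (l : nat) (nu mu : seq (seq nat))
    (x : seq (seq nat) * seq (seq (seq nat))) (ST : tableau * tableau) : Prop :=
  exists G, forall c, c < l ->
    [/\ growth (size (idx nu)) (size (idx mu)) (kernel x c) (G c),
        forall r i, r <= size (idx nu) ->
          G c r (size (idx mu)) i = row_count nu ST.1 c r i &
        forall s i, s <= size (idx mu) ->
          G c (size (idx nu)) s i = row_count mu ST.2 c s i].

Lemma RSK_rel_total l m nu mu x : Lambda_st l m nu -> Lambda_st l m mu ->
  ParMat nu mu x -> exists2 ST, SST2 l m nu mu ST & RSK_rel l nu mu x ST.
Proof.
move=> lnu lmu px; have [snu _] := lnu; have [smu _] := lmu.
have [k0 kr kc] := kernel_spec snu smu px.
set R := size (idx nu); set S := size (idx mu).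
pose G c := sval (constructive_indefinite_description _ (growth_exists R S (kernel x c))).
have gG c : growth R S (kernel x c) (G c).
  exact: svalP (constructive_indefinite_description _ _).
have [RN SN] : R <= R + S /\ S <= R + S by lia.
have ych : chain nu l (R + S) (fun c r => G c r S).
  apply: (growth_chain RN (fun c _ => gG c)) => // c r s _ rR sS bc.
  by apply: k0 => //; lia.
have zch : chain mu l (R + S) (fun c s => G c R s).
  apply: (growth_chain SN (fun c _ => growth_transpose (gG c))) => // c s r _ sS rR bc.
  by apply: k0 => //; lia.
exists (chain_tableau nu l (R + S) (fun c r => G c r S),
        chain_tableau mu l (R + S) (fun c s => G c R s)).
  exists (chain_shape nu l (R + S) (fun c r => G c r S)); split.
  - exact: chain_shape_Par.
  - exact: chain_tableau_SST.
  (* Both chains end at [G c R S] and use the same bound [R + S], so the two shapes are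
     convertible. *)
  - exact: (chain_tableau_SST zch SN).
exists G => c cl; split=> //= [r i rR|s i sS].
  by rewrite (row_count_chain_tableau ych).
by rewrite (row_count_chain_tableau zch).
Qed.

Lemma RSK_rel_onto l m nu mu ST : Lambda_st l m nu -> Lambda_st l m mu ->
  SST2 l m nu mu ST -> exists2 x, ParMat nu mu x & RSK_rel l nu mu x ST.
Proof.
move=> lnu lmu; have [snu _] := lnu; have [smu _] := lmu.
case: ST => U V [lam [/= pl sU sV]].
set R := size (idx nu); set S := size (idx mu).
have [RN SN] : R <= R + S /\ S <= R + S by lia.
have ych := row_count_chain pl sU RN; have zch := row_count_chain pl sV SN.
have ex c : exists KG : (nat -> nat -> nat) * (nat -> nat -> nat -> nat), c < l ->
    [/\ growth R S KG.1 KG.2,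
        forall r i, r <= R -> KG.2 r S i = row_count nu U c r i &
        forall s i, s <= S -> KG.2 R s i = row_count mu V c s i].
  (* A dummy pair for [c >= l] lets the choice range over all [c]. *)
  case: (ltnP c l) => cl; last by exists (fun _ _ => 0, fun _ _ _ => 0).
  have [y0 yh _ _] := ych; have [z0 zh _ _] := zch.
  have [||||i|K [G [g1 g2 g3]]] :=
    @growth_exists_boundary R S (row_count nu U c) (row_count mu V c).
  - by move=> i; apply: y0.
  - by move=> i; apply: z0.
  - by move=> r; apply: yh.
  - by move=> s; apply: zh.
  (* The chains meet at the corner because both tableaux have shape [lam]. *)
  - by rewrite (row_count_full _ _ sU) (row_count_full _ _ sV).
  by exists (K, G).
pose KG c := sval (constructive_indefinite_description _ (ex c)).
have KGP c : c < l -> _ := svalP (constructive_indefinite_description _ (ex c)).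
rewrite -/(KG _) in KGP.
have gG c : c < l -> growth R S (KG c).1 (KG c).2 by move=> /KGP [].
(* The first chain controls support and margins by rows; the transposed diagrams do the same by
   columns. *)
have [k0 kr] : _ /\ _ := chain_growth RN ych gG
   (fun c r i cl => let: And3 _ h _ := KGP c cl in h r i).
have [k0' kc] : _ /\ _ := chain_growth SN zch (fun c cl => growth_transpose (gG c cl))
   (fun c r i cl => let: And3 _ _ h := KGP c cl in h r i).
have [c r s cl rR sS|||x px kx] := @kernel_surj l nu mu (fun c => (KG c).1) snu smu.
- by rewrite geq_min => /orP [h|h]; [apply: k0 | apply: k0'].
- exact: kr.
- exact: kc.
exists x => //; exists (fun c => (KG c).2) => c cl.
(* The local rule is imposed only inside the matrix, where [kernel x] agrees with the entries
   found. *)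
have [[g0 g1 g2 g3 g4] h1 h2] := KGP c cl; split=> //; split=> // r s rR sS.
by rewrite kx //; apply: g2.
Qed.

(** The matrices determine the diagrams, these the chains on the far boundary, and the chains the
    tableaux. *)
Lemma RSK_rel_functional l m nu mu x ST ST' : SST2 l m nu mu ST -> SST2 l m nu mu ST' ->
  RSK_rel l nu mu x ST -> RSK_rel l nu mu x ST' -> ST = ST'.
Proof.
case: ST ST' => [U V] [U' V'] [lam [/= pl sU sV]] [lam' [/= pl' sU' sV']] [G hG] [G' hG'].
have E c r s i : c < l -> r <= size (idx nu) -> s <= size (idx mu) -> G c r s i = G' c r s i.
  by move=> cl; have [g _ _] := hG c cl; have [g' _ _] := hG' c cl;
    apply: growth_unique g g' _ r s i.
congr pair.
  apply: (row_count_inj pl pl' sU sU') => c r i cl rR.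
  by have [_ h _] := hG c cl; have [_ h' _] := hG' c cl; rewrite -h // -h' // E.
apply: (row_count_inj pl pl' sV sV') => c s i cl sS.
by have [_ _ h] := hG c cl; have [_ _ h'] := hG' c cl; rewrite -h // -h' // E.
Qed.

(** The tableaux fix the far boundary, hence all entries, and these fix the decorated matrix. *)
Lemma RSK_rel_injective l nu mu x x' ST : size nu = l -> size mu = l ->
  ParMat nu mu x -> ParMat nu mu x' ->
  RSK_rel l nu mu x ST -> RSK_rel l nu mu x' ST -> x = x'.
Proof.
move=> snu smu px px' [G hG] [G' hG']; apply: (kernel_inj snu smu px px') => c r s cl.
have [g h1 h2] := hG c cl; have [g' h1' h2'] := hG' c cl.
apply: (growth_unique_boundary g g') => [k i kn|k i kn]; first by rewrite h1 ?h1'.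
by rewrite h2 ?h2'.
Qed.

Theorem theorem5p6 (l m : nat) (mu nu : seq (seq nat)) :
  1 <= l -> Lambda_st l m mu -> Lambda_st l m nu ->
  exists phi : seq (seq nat) * seq (seq (seq nat)) -> tableau * tableau,
    bijection_between (ParMat nu mu) (SST2 l m nu mu) phi.
Proof.
move=> _ lmu lnu; have [smu _] := lmu; have [snu _] := lnu.
apply: (@bijection_of_relation _ _ ([::], [::]) _ _ (RSK_rel l nu mu)).
- by move=> x; apply: RSK_rel_total.
- by move=> ST; apply: RSK_rel_onto.
- by move=> x ST ST' _; apply: RSK_rel_functional.
- by move=> x x' ST px px' _; apply: RSK_rel_injective.
Qed.
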